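(* Let $q,t\in(0,1)$, $\zeta_+>0$, $\zeta_-<0$ be fixed. For any coherent system $\{M_N\}_{N\ge1}$ of the extended Macdonald chain $\{\mathrm{DSign}(N),\Lambda^N_{N-1}\}$, the measures $M_N$, viewed as probability measures on $\widetilde{\mathrm{DSign}}$, converge as $N\to\infty$ to the boundary measure $M_\infty$ of the system in the weak topology of measures on the space $\widetilde{\mathrm{DSign}}$.
   Context: $\mathrm{Sign}(k)$ is the set of vectors $(a_1,\dots,a_k)\in\mathbb Z^k$ with $a_1\ge\dots\ge a_k$; $\mathrm{Sign}(0)=\{\varnothing\}$. $\mathrm{DSign}(N)$ is the set of pairs $a=(a^+,a^-)$ with $a^+\in\mathrm{Sign}(k)$, $a^-\in\mathrm{Sign}(l)$, $k,l\ge0$, $k+l=N$ (double signatures); $\mathrm{DSign}(0)$ is a singleton. An infinite signature is an infinite sequence of integers $a_1\ge a_2\ge\cdots$; $\mathrm{DSign}(\infty)$ is the set of pairs $(a^+,a^-)$ of signatures (each finite, possibly empty, or infinite), at least one of which is infinite. For $a\in\mathrm{DSign}(N)$ (with $a^+\in\mathrm{Sign}(k)$, $a^-\in\mathrm{Sign}(l)$) and $b\in\mathrm{DSign}(N-1)$, one writes $b\prec a$ if either (1) $k>0$, $b^+\in\mathrm{Sign}(k-1)$, $b^-\in\mathrm{Sign}(l)$, $a^+_1\ge b^+_1\ge\dots\ge a^+_{k-1}\ge b^+_{k-1}\ge a^+_k$, $a^-_1\ge b^-_1\ge\dots\ge a^-_l\ge b^-_l$; or (2) $l>0$, $b^+\in\mathrm{Sign}(k)$,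 $b^-\in\mathrm{Sign}(l-1)$, $a^+_1\ge b^+_1\ge\dots\ge a^+_k\ge b^+_k$, $a^-_1\ge b^-_1\ge\dots\ge a^-_{l-1}\ge b^-_{l-1}\ge a^-_l$. For a finite or infinite double signature $a$, $X(a):=\{\zeta_+q^{-a^+_i}t^{i-1}\}_i\cup\{\zeta_-q^{-a^-_i}t^{i-1}\}_i\subset\mathbb R\setminus\{0\}$, where $i$ ranges over all indices of coordinates of $a^+$, resp. $a^-$ (distinct double signatures give distinct sets); write $X_N(a)=X(a)$ for $a\in\mathrm{DSign}(N)$ and $X_\infty(a)=X(a)$ for $a\in\mathrm{DSign}(\infty)$. $\widetilde{\mathrm{DSign}}:=\mathrm{DSign}(\infty)\sqcup\bigsqcup_{N=0}^\infty\mathrm{DSign}(N)$, with the uniform structure (hence topology) in which two elements $a,b$ are $\varepsilon$-close ($\varepsilon>0$ small) if $X(a)$ and $X(b)$ coincide outside $(-\varepsilon,\varepsilon)$. $\mathrm{DSign}(\infty)$ carries the induced Borel structure. $\mathbb Y(N)$: partitions with at most $N$ nonzero parts. $P_{\nu\mid N}(\cdot;q,t)$: the $N$-variate Macdonald polynomial, with coefficient $1$ at $x_1^{\nu_1}\cdots x_N^{\nu_N}$; $P_\nu(\cdot;q,t)$: the Macdonald symmetric function; both are evaluated at point configurations by substituting the points for the variables. $(z;q,t)_\nu:=\prod_{(i,j)\in\nu}(1-zq^{j-1}t^{1-i})$, product over boxes (row $i$, column $j$). For each $N\ge2$, $\Lambda^N_{N-1}$ is the unique stochastic matrix of format $\mathrm{DSign}(N)\times\mathrm{DSign}(N-1)$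 with $\Lambda^N_{N-1}(a,b)>0$ if $b\prec a$, $=0$ otherwise, and $\sum_{b}\Lambda^N_{N-1}(a,b)\frac{P_{\nu\mid N-1}(X_{N-1}(b);q,t)}{(t^{N-1};q,t)_\nu}=\frac{P_{\nu\mid N}(X_N(a);q,t)}{(t^N;q,t)_\nu}$ for all $a\in\mathrm{DSign}(N)$, $\nu\in\mathbb Y(N-1)$. A coherent system is a sequence of probability measures $M_N$ on $\mathrm{DSign}(N)$, $N\ge1$, with $\sum_a M_N(a)\Lambda^N_{N-1}(a,b)=M_{N-1}(b)$ for all $N\ge2$, $b\in\mathrm{DSign}(N-1)$. The boundary of the chain (set of extreme coherent systems) is identified with $\mathrm{DSign}(\infty)$: to $a\in\mathrm{DSign}(\infty)$ corresponds the coherent system $\{\Lambda^\infty_N(a,\cdot)\}_N$, where $\Lambda^\infty_N(a,\cdot)$ is the probability measure on $\mathrm{DSign}(N)$ uniquely determined by $\sum_{b}\Lambda^\infty_N(a,b)\frac{P_{\nu\mid N}(X_N(b);q,t)}{(t^N;q,t)_\nu}=P_\nu(X_\infty(a);q,t)$ for all $\nu\in\mathbb Y(N)$. The boundary measure of $\{M_N\}$ is the unique probability Borel measure $M_\infty$ on $\mathrm{DSign}(\infty)$ with $M_\infty\Lambda^\infty_N=M_N$ for all $N\ge1$, i.e. $M_N(b)=\int M_\infty(da)\Lambda^\infty_N(a,b)$. *)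

(* Defs.v *)
From HB Require Import structures.
From mathcomp Require Import all_boot all_order all_algebra.
From mathcomp Require Import all_classical all_reals all_analysis.

Set Implicit Arguments.
Unset Strict Implicit.
Unset Printing Implicit Defensive.
Import Order.TTheory GRing.Theory Num.Theory.
Import numFieldNormedType.Exports.

Local Open Scope classical_set_scope.
Local Open Scope ring_scope.

(* A partition of d has at most d nonzero parts; it is stored as a weakly
   decreasing d-tuple padded with zeros. *)
Definition part (d : nat) : Type :=
  {s : d.-tuple 'I_d.+1 |
    sorted geq (map val s) && (sumn (map val s) == d)}.

HB.instance Definition _ (d : nat) := Finite.on (part d).

(* The nonzero parts, in decreasing order; their number is the length. *)
Definition parts (d : nat) (lam : part d) : seq nat :=
  [seq k <- map val (val lam) | k != 0%N].

Definition dominated (d : nat) (mu lam : part d) : Prop :=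
  forall i : nat,
    (sumn (take i (parts mu)) <= sumn (take i (parts lam)))%N.

(* A homogeneous symmetric function of degree d with real coefficients is
   given by the coefficients c of its expansion in the basis of products
   p_rho = p_{rho_1} p_{rho_2} ... of power sums; sym_eval c p is its value
   when each power sum p_k takes the value p k. *)
Definition sym_eval (R : realType) (d : nat) (c : part d -> R) (p : nat -> R) : R :=
  \sum_(rho : part d) c rho * \prod_(k <- parts rho) p k.

(* Monomial symmetric polynomial: the sum of x^alpha over the distinct
   rearrangements alpha of mu padded with zeros. *)
Definition monomial_sym (R : realType) (mu : seq nat) (xs : seq R) : R :=
  if (size mu <= size xs)%N then
    \sum_(alpha <- permutations (mu ++ nseq (size xs - size mu) 0%N))
      \prod_(i < size xs) xs`_i ^+ nth 0%N alpha i
  else 0.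

(* z_rho(q,t), the squared norm of p_rho for the (q,t)-scalar product. *)
Definition zqt (R : realType) (q t : R) (d : nat) (rho : part d) : R :=
  \prod_(1 <= i < d.+1)
     (i ^ count_mem i (parts rho) * (count_mem i (parts rho))`!)%N%:R
  * \prod_(k <- parts rho) ((1 - q ^+ k) / (1 - t ^+ k)).

Definition qt_scalar (R : realType) (q t : R) (d : nat) (f g : part d -> R) : R :=
  \sum_(rho : part d) f rho * g rho * zqt q t rho.

(* P lam is the family of power-sum coefficients of the Macdonald symmetric
   function P_lam(q,t): the P_lam are pairwise orthogonal and unitriangular
   with respect to the monomial symmetric functions, in the dominance order.
   The N-variate polynomial P_{nu|N} is the specialization of P_nu to N
   variables. *)
Definition is_macdonald (R : realType) (q t : R)
    (P : forall d : nat, part d -> part d -> R) : Prop :=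
  forall d : nat,
    (forall lam mu : part d, lam <> mu -> qt_scalar q t (P d lam) (P d mu) = 0) /\
    (forall lam : part d, exists u : part d -> R,
      [/\ u lam = 1,
          forall mu : part d, u mu != 0 -> dominated mu lam &
          forall xs : seq R,
            sym_eval (P d lam) (fun k => \sum_(x <- xs) x ^+ k) =
            \sum_(mu : part d) u mu * monomial_sym (parts mu) xs]).

(* (z;q,t)_nu, with rows and columns numbered from 0. *)
Definition qtpoch (R : realType) (q t z : R) (d : nat) (nu : part d) : R :=
  \prod_(0 <= i < size (parts nu)) \prod_(0 <= j < nth 0%N (parts nu) i)
    (1 - z * q ^+ j * t ^- i).

(* A finite or infinite signature; coordinates are numbered from 0, and
   entry i = None when there is no i-th coordinate. *)
Record signature := Signature {
  entry : nat -> option int ;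
  entryP : forall (i : nat) (m : int), entry i.+1 = Some m ->
    exists2 m' : int, entry i = Some m' & m <= m' }.

Definition has_length (s : signature) (k : nat) : Prop :=
  forall i : nat, entry s i <> None <-> (i < k)%N.

Definition endless (s : signature) : Prop := forall i : nat, entry s i <> None.

Lemma zero_signatureP (o : nat -> bool) (i : nat) (m : int) :
  (forall i, o i.+1 -> o i) ->
  (if o i.+1 then Some (0 : int) else None) = Some m ->
  exists2 m' : int, (if o i then Some (0 : int) else None) = Some m' & m <= m'.
Proof.
move=> oP; case: ifPn => // /oP -> [<-].
by exists 0.
Qed.

Definition zero_signature (k : nat) : signature :=
  @Signature (fun i => if (i < k)%N then Some 0 else None)
    (fun i m => @zero_signatureP (fun i => (i < k)%N) i m (fun i => @ltnW i.+1 k)).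

Definition zero_infinite_signature : signature :=
  @Signature (fun i => Some 0)
    (fun i m => @zero_signatureP xpredT i m (fun _ => id)).

HB.instance Definition _ := gen_eqMixin signature.
HB.instance Definition _ := gen_choiceMixin signature.
HB.instance Definition _ := isPointed.Build signature (zero_signature 0).

(* Pairs (a+, a-) of arbitrary signatures: either both are finite, and the
   pair lies in DSign(N) for N the sum of the lengths, or at least one is
   infinite, and the pair lies in DSign(oo). *)
Definition dsign : Type := (signature * signature)%type.

HB.instance Definition _ := Choice.on dsign.
HB.instance Definition _ := Pointed.on dsign.

Definition dsign_level (N : nat) : set dsign :=
  [set a | exists k l : nat,
    [/\ (k + l)%N = N, has_length a.1 k & has_length a.2 l]].

Definition dsign_infinite : set dsign := [set a | endless a.1 \/ endless a.2].

(* DSign(N), a countable set with the sigma-algebra of all subsets. *)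
Definition DSign (N : nat) : Type := set_type (dsign_level N).

Lemma dsign_level_zero (N : nat) :
  (zero_signature N, zero_signature 0) \in dsign_level N.
Proof.
apply/mem_set; exists N, 0%N; split; first by rewrite addn0.
- by move=> i /=; case: ifP.
- by move=> i /=.
Qed.

HB.instance Definition _ (N : nat) := Choice.on (DSign N).
HB.instance Definition _ (N : nat) := isPointed.Build (DSign N)
  (exist _ (zero_signature N, zero_signature 0) (dsign_level_zero N)).
HB.instance Definition _ (N : nat) :=
  @isMeasurable.Build default_measure_display (DSign N)
    discrete_measurable discrete_measurable0
    discrete_measurableC discrete_measurableU.

(* u_1 >= v_1 >= u_2 >= v_2 >= ..., for all the coordinates that exist. *)
Definition interlace (u v : signature) : Prop :=
  forall (i : nat) (x y : int),
    (entry u i = Some x -> entry v i = Some y -> y <= x) /\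
    (entry v i = Some x -> entry u i.+1 = Some y -> y <= x).

Definition prec (b a : dsign) : Prop :=
  exists k l : nat,
    [/\ has_length a.1 k, has_length a.2 l,
        [/\ (0 < k)%N, has_length b.1 k.-1 & has_length b.2 l] \/
        [/\ (0 < l)%N, has_length b.1 k & has_length b.2 l.-1],
        interlace a.1 b.1 & interlace a.2 b.2].

(* The point zeta q^{-m} t^{i-1} attached to the coordinate m = s_i (here i is
   numbered from 0), and 0 if there is no such coordinate. *)
Definition node (R : realType) (q t z : R) (s : signature) (i : nat) : R :=
  if entry s i is Some m then z * q ^ (- m) * t ^+ i else 0.

Definition config (R : realType) (q t zp zm : R) (a : dsign) : set R :=
  [set node q t zp a.1 i | i in [set i | entry a.1 i <> None]] `|`
  [set node q t zm a.2 i | i in [set i | entry a.2 i <> None]].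

(* The power sum of degree k > 0 at the variables X(a); coordinates that do
   not exist contribute zero variables, and for finite a this is a finite
   sum. *)
Definition psum (R : realType) (q t zp zm : R) (a : dsign) (k : nat) : R :=
  limn (series (fun i => node q t zp a.1 i ^+ k + node q t zm a.2 i ^+ k)).

(* The value at X(a) of the symmetric function with power-sum coefficients c. *)
Definition sym_at (R : realType) (q t zp zm : R) (d : nat) (c : part d -> R)
    (a : dsign) : R :=
  sym_eval c (psum q t zp zm a).

Definition eps_close (R : realType) (q t zp zm e : R) (a b : dsign) : Prop :=
  config q t zp zm a `\` `]- e, e[ = config q t zp zm b `\` `]- e, e[.

(* The union of DSign(oo) and of all the DSign(N), as a uniform space. *)
Definition dsign_space (R : realType) (q t zp zm : R) : Type := dsign.

Section uniform_structure.
Context {R : realType} {q t zp zm : R}.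
Local Notation T := (dsign_space q t zp zm).

Definition dsign_entourage : set_system (T * T) :=
  [set E | exists2 e : R, 0 < e &
    [set ab | eps_close q t zp zm e ab.1 ab.2] `<=` E].

Lemma eps_close_le (e e' : R) (a b : dsign) :
  e <= e' -> eps_close q t zp zm e a b -> eps_close q t zp zm e' a b.
Proof.
move=> ee' ab.
have sub : (`]- e, e[ : set R) `<=` `]- e', e'[.
  move=> x /=; rewrite !in_itv /= => /andP[ex xe].
  by rewrite (le_lt_trans _ ex) ?lerN2// (lt_le_trans xe).
rewrite /eps_close; have h (A : set R) :
    A `\` `]- e', e'[ = (A `\` `]- e, e[) `\` `]- e', e'[.
  by rewrite setDDl; congr (_ `\` _); apply/esym/setUidPr.
by rewrite h ab -h.
Qed.

Lemma dsign_entourage_filter : Filter dsign_entourage.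
Proof.
split.
- by exists 1.
- move=> E F [e e0 eE] [f f0 fF]; exists (Num.min e f).
    by rewrite lt_min e0 f0.
  move=> ab ab_close; split.
  + by apply: eE; apply: eps_close_le ab_close; rewrite ge_min lexx.
  + by apply: fF; apply: eps_close_le ab_close; rewrite ge_min lexx orbT.
- by move=> E F EF [e e0 eE]; exists e => //; exact: subset_trans eE EF.
Qed.

Local Open Scope relation_scope.

Lemma dsign_entourage_diagonal (E : set (T * T)) :
  dsign_entourage E -> diagonal `<=` E.
Proof. by move=> [e e0 eE] [a b] ab; apply: eE; have -> : a = b by []. Qed.

Lemma dsign_entourage_inv (E : set (T * T)) :
  dsign_entourage E -> dsign_entourage E^-1.
Proof.
by move=> [e e0 eE]; exists e => // -[a b] ab; apply: eE; exact: esym.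
Qed.

Lemma dsign_entourage_split_ex (E : set (T * T)) :
  dsign_entourage E -> exists2 F, dsign_entourage F & F \; F `<=` E.
Proof.
move=> [e e0 eE].
exists [set ab | eps_close q t zp zm e ab.1 ab.2]; first by exists e.
by move=> [a b] [c ac cb]; apply: eE; exact: etrans ac cb.
Qed.

End uniform_structure.

HB.instance Definition _ (R : realType) (q t zp zm : R) :=
  Choice.on (dsign_space q t zp zm).
HB.instance Definition _ (R : realType) (q t zp zm : R) :=
  Pointed.on (dsign_space q t zp zm).
HB.instance Definition _ (R : realType) (q t zp zm : R) :=
  isUniform.Build (dsign_space q t zp zm)
    (@dsign_entourage_filter R q t zp zm)
    (@dsign_entourage_diagonal R q t zp zm)
    (@dsign_entourage_inv R q t zp zm)
    (@dsign_entourage_split_ex R q t zp zm).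

(* DSign(oo), with the induced topology. *)
Definition DSign_inf (R : realType) (q t zp zm : R) : Type :=
  set_type (dsign_infinite : set (dsign_space q t zp zm)).

Lemma dsign_infinite_zero :
  (zero_infinite_signature, zero_infinite_signature) \in dsign_infinite.
Proof. by apply/mem_set; left => i. Qed.

HB.instance Definition _ (R : realType) (q t zp zm : R) :=
  Uniform.on (DSign_inf q t zp zm).
HB.instance Definition _ (R : realType) (q t zp zm : R) :=
  isPointed.Build (DSign_inf q t zp zm)
    (exist _ (zero_infinite_signature, zero_infinite_signature)
       dsign_infinite_zero).

Notation borel T := (g_sigma_algebraType (open : set (set T))).

Definition incl_fin (R : realType) (q t zp zm : R) (N : nat) (b : DSign N) :
  borel (dsign_space q t zp zm) := val b.

Definition incl_inf (R : realType) (q t zp zm : R)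
  (a : borel (DSign_inf q t zp zm)) : borel (dsign_space q t zp zm) := val a.

Lemma measurable_incl_fin (R : realType) (q t zp zm : R) (N : nat) :
  measurable_fun [set: DSign N] (@incl_fin R q t zp zm N).
Proof. by []. Qed.

Lemma measurable_incl_inf (R : realType) (q t zp zm : R) :
  measurable_fun [set: borel (DSign_inf q t zp zm)] (@incl_inf R q t zp zm).
Proof.
apply: measurability; first by [].
move=> _ [B oB <-]; rewrite setTI; apply: sub_sigma_algebra.
by exists B.
Qed.

HB.instance Definition _ (R : realType) (q t zp zm : R) (N : nat) :=
  isMeasurableFun.Build _ _ _ _ (@incl_fin R q t zp zm N)
    (@measurable_incl_fin R q t zp zm N).
HB.instance Definition _ (R : realType) (q t zp zm : R) :=
  isMeasurableFun.Build _ _ _ _ (@incl_inf R q t zp zm)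
    (@measurable_incl_inf R q t zp zm).

(* Entries of stochastic matrices are the values at singletons; sums over the
   countable sets DSign(N) are written as integrals. *)
Definition is_macdonald_chain (R : realType) (q t zp zm : R)
    (P : forall d : nat, part d -> part d -> R)
    (L : forall N : nat, R.-pker (DSign N.+1) ~> (DSign N)) : Prop :=
  forall (N : nat) (a : DSign N.+1), (0 < N)%N ->
    (forall b : DSign N,
       (prec (val b) (val a) -> (0 < L N a [set b])%E) /\
       (~ prec (val b) (val a) -> L N a [set b] = 0%E)) /\
    (forall (d : nat) (nu : part d), (size (parts nu) <= N)%N ->
       (\int[L N a]_b
          (sym_at q t zp zm (P d nu) (val b) / qtpoch q t (t ^+ N) nu)%:E =
       (sym_at q t zp zm (P d nu) (val a) / qtpoch q t (t ^+ N.+1) nu)%:E)%E).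

Definition is_boundary_kernel (R : realType) (q t zp zm : R)
    (P : forall d : nat, part d -> part d -> R)
    (Linf : forall N : nat,
      R.-pker (borel (DSign_inf q t zp zm)) ~> (DSign N)) : Prop :=
  forall (N : nat) (a : DSign_inf q t zp zm), (0 < N)%N ->
    forall (d : nat) (nu : part d), (size (parts nu) <= N)%N ->
      (\int[Linf N a]_b
         (sym_at q t zp zm (P d nu) (val b) / qtpoch q t (t ^+ N) nu)%:E =
      (sym_at q t zp zm (P d nu) (val a))%:E)%E.

Definition coherent_system (R : realType)
    (L : forall N : nat, R.-pker (DSign N.+1) ~> (DSign N))
    (M : forall N : nat, probability (DSign N) R) : Prop :=
  forall (N : nat) (b : DSign N), (0 < N)%N ->
    (\int[M N.+1]_a L N a [set b] = M N [set b])%E.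

Definition is_boundary_measure (R : realType) (q t zp zm : R)
    (Linf : forall N : nat,
      R.-pker (borel (DSign_inf q t zp zm)) ~> (DSign N))
    (M : forall N : nat, probability (DSign N) R)
    (Minf : probability (borel (DSign_inf q t zp zm)) R) : Prop :=
  forall (N : nat) (b : DSign N), (0 < N)%N ->
    (M N [set b] = \int[Minf]_a Linf N a [set b])%E.

Definition weak_cvg (R : realType) (T : ptopologicalType)
    (mu : nat -> probability (borel T) R) (nu : probability (borel T) R) : Prop :=
  forall f : T -> R, continuous f -> bounded_fun f ->
    ((fun n : nat => \int[mu n]_x (f x)%:E) @ \oo --> \int[nu]_x (f x)%:E)%E.

(* Main.v *)
Require Import Defs.
From HB Require Import structures.
From mathcomp Require Import all_boot all_order all_algebra.
From mathcomp Require Import all_classical all_reals all_analysis.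
From mathcomp Require Import measurable_realfun.
From mathcomp Require Import ring lra zify.
Import Order.TTheory GRing.Theory Num.Theory.
Import numFieldNormedType.Exports.
Local Open Scope classical_set_scope.
Local Open Scope ring_scope.
Set Implicit Arguments.
Unset Strict Implicit.
Unset Printing Implicit Defensive.

(** Since M_N is the mixture of the measures Λ^∞_N(a, ·) over M_∞, dominated
    convergence reduces the theorem to Λ^∞_N(a, ·) -> δ_a for each a.  As
    (t^N;q,t)_ν -> 1 and the P_ν form a basis of the symmetric functions, the
    defining identities of Λ^∞_N say that the mean of every symmetric function
    converges to its value at a.  Applied to a linear combination h of power
    sums and to its square, this gives E (h(b) - h(a))^2 -> 0.  Finally,
    finitely many such h decide whether b is ε-close to a: p_2 bounds the nodes
    of b, so that those outside (-ε/2, ε/2) lie in a fixed finite set S, and for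
    each s in S with |s| >= ε a suitable h detects whether s is a node of b. *)

(** * The basis of Macdonald functions *)

Lemma geq_trans : transitive geq.
Proof. by move=> y x z /= xy yz; exact: leq_trans yz xy. Qed.

Lemma geq_anti : antisymmetric geq.
Proof. by move=> x y; rewrite andbC => /anti_leq. Qed.

Lemma parts_gt0 d (rho : part d) k : k \in parts rho -> (0 < k)%N.
Proof. by rewrite mem_filter lt0n => /andP[]. Qed.

Lemma size_parts d (rho : part d) : (size (parts rho) <= d)%N.
Proof.
by rewrite size_filter (leq_trans (count_size _ _))// size_map size_tuple.
Qed.

(** [parts] discards only zeros, so padding it back to length [d] recovers the stored tuple up to
    order; [monomial_sym] pads in the same way. *)
Lemma perm_parts d (rho : part d) :
  perm_eq (parts rho ++ nseq (d - size (parts rho)) 0%N) (map val (val rho)).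
Proof.
rewrite /parts; set s := map val (val rho).
have ss : size s = d by rewrite size_map size_tuple.
rewrite -(permPr (permEl (perm_filterC (fun k => k != 0%N) s))) perm_cat2l.
suff -> : [seq x <- s | ~~ (x != 0%N)] = nseq (d - size [seq k <- s | k != 0%N]) 0%N.
  exact: perm_refl.
rewrite -[in RHS]ss -(count_predC (fun k => k != 0%N) s) size_filter addKn -size_filter.
by apply/all_pred1P/allP => x; rewrite mem_filter /= negbK => /andP[].
Qed.

(** Positive entries with sum [d] number at most [d] and are each at most [d], so the padded
    sequence fits the encoding of [part d]. *)
Lemma part_of_seq d (s : seq nat) : sorted geq s -> 0%N \notin s ->
  sumn s = d -> exists rho : part d, parts rho = s.
Proof.
move=> s_sorted s0 sd.
have s_size : (size s <= d)%N.
  rewrite -sd; elim: s s0 {s_sorted sd} => //= a s IH.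
  rewrite in_cons negb_or => /andP[a0 /IH sIH].
  by rewrite -add1n leq_add// lt0n eq_sym.
pose s' := s ++ nseq (d - size s) 0%N.
have s'_size : size [seq inord k : 'I_d.+1 | k <- s'] == d.
  by rewrite size_map size_cat size_nseq subnKC.
have vals : map val [seq inord k : 'I_d.+1 | k <- s'] = s'.
  rewrite -map_comp -[RHS]map_id; apply/eq_in_map => k ks /=.
  rewrite inordK// ltnS; move: ks; rewrite mem_cat => /orP[ks|]; last first.
    by rewrite mem_nseq => /andP[_ /eqP ->].
  rewrite -sd; elim: s ks {s' s'_size s_sorted s0 sd s_size} => //= a s IH.
  rewrite in_cons => /orP[/eqP ->|/IH ks]; first exact: leq_addr.
  by rewrite (leq_trans ks)// leq_addl.
have s'P : sorted geq (map val (Tuple s'_size)) && (sumn (map val (Tuple s'_size)) == d).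
  rewrite [map val _]vals sumn_cat sumn_nseq mul0n addn0 sd eqxx andbT.
  rewrite sorted_pairwise; last exact: geq_trans.
  rewrite pairwise_cat -!sorted_pairwise ?s_sorted; try exact: geq_trans.
  apply/andP; split.
    by apply/allrelP => x y _; rewrite mem_nseq => /andP[_ /eqP ->].
  by elim: (d - size s)%N => //= -[|n]//.
exists (exist _ (Tuple s'_size) s'P).
rewrite /parts [map val _]vals filter_cat [X in _ ++ X](_ : _ = [::]); last first.
  by elim: (d - size s)%N.
rewrite cats0; apply/all_filterP/allP => x xs.
by apply: contraNneq s0 => <-.
Qed.

(** The number with base-[D] digits [s], lowest first: the exponent of [z] in the monomial [x^s] at
    [x_i = z^(D^i)]. *)
Definition code (D : nat) (s : seq nat) : nat := (\sum_(i < size s) D ^ i * nth 0 s i)%N.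

Lemma code_cons D a s : code D (a :: s) = (a + code D s * D)%N.
Proof.
rewrite /code /= big_ord_recl /= expn0 mul1n big_distrl /=; congr addn.
by apply: eq_bigr => i _; rewrite /bump /= add1n expnS -mulnA mulnC.
Qed.

Lemma code_inj D (s s' : seq nat) : size s = size s' ->
  all (fun k => k < D)%N s -> all (fun k => k < D)%N s' ->
  code D s = code D s' -> s = s'.
Proof.
elim: s s' => [[]//|a s IH [//|a' s'] /= [ss'] /andP[aD sD] /andP[a'D s'D]].
rewrite !code_cons => e.
have aa' : a = a'.
  by have := congr1 (modn^~ D) e; rewrite /= ![(_ + _ * D)%N]addnC !modnMDl !modn_small.
rewrite aa'; congr (_ :: _); apply: IH => //; apply/eqP.
move/eqP: e; rewrite aa' eqn_add2l eqn_pmul2r//.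
exact: leq_ltn_trans aD.
Qed.

Section monomial_independence.
Variable R : realType.

(* Kronecker substitution x_i = z^(D^i) turns distinct monomials of degree < D
   in each variable into distinct powers of z. *)
Lemma monomial_sym_kronecker d (mu : part d) (z : R) :
  monomial_sym (parts mu) (mkseq (fun i => z ^+ (d.+1 ^ i)) d) =
  (\sum_(alpha <- permutations (map val (val mu))) 'X^(code d.+1 alpha)).[z].
Proof.
rewrite /monomial_sym size_mkseq size_parts horner_sum.
rewrite (perm_big _ (perm_permutations (perm_parts mu))) /=.
apply: eq_big_seq => alpha; rewrite mem_permutations => /perm_size.
rewrite size_map size_tuple hornerXn => sa.
rewrite /code sa expr_sum; apply: eq_bigr => i _.
by rewrite nth_mkseq// exprM.
Qed.

Lemma poly_eq0_horner (p : {poly R}) : (forall z, p.[z] = 0) -> p = 0.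
Proof.
move=> p0; apply/eqP/negPn/negP => pn0.
have := max_poly_roots pn0 (rs := [seq i%:R | i <- iota 0 (size p)]).
rewrite size_map size_iota ltnn => H; suff: false by []; apply: H.
  by apply/allP => x _; apply/rootP.
by rewrite map_inj_uniq ?iota_uniq// => i j /eqP; rewrite eqr_nat => /eqP.
Qed.

(** The Kronecker substitution gives a polynomial identity. At the exponent coding [lam] only [lam]
    contributes, since a sorted tuple is determined by any of its rearrangements. *)
Lemma monomial_sym_free d (u : part d -> R) :
  (forall xs : seq R, \sum_(mu : part d) u mu * monomial_sym (parts mu) xs = 0) ->
  forall lam, u lam = 0.
Proof.
move=> u0 lam.
pose G : {poly R} := \sum_(mu : part d) u mu *:
  \sum_(alpha <- permutations (map val (val mu))) 'X^(code d.+1 alpha).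
have G0 : G = 0.
  apply: poly_eq0_horner => z.
  rewrite -[RHS](u0 (mkseq (fun i => z ^+ (d.+1 ^ i)) d)) horner_sum.
  by apply: eq_bigr => mu _; rewrite hornerZ monomial_sym_kronecker.
have bounded (mu : part d) s : s \in permutations (map val (val mu)) ->
    all (fun k => k < d.+1)%N s.
  rewrite mem_permutations => /perm_all ->.
  by rewrite all_map; apply/allP => i _ /=; exact: ltn_ord.
have size_perm (mu : part d) s : s \in permutations (map val (val mu)) -> size s = d.
  by rewrite mem_permutations => /perm_size; rewrite size_map size_tuple.
have self (mu : part d) : map val (val mu) \in permutations (map val (val mu)).
  by rewrite mem_permutations.
have := congr1 (fun p : {poly R} => p`_(code d.+1 (map val (val lam)))) G0.
rewrite coef0 coef_sum (bigD1 lam)//= [X in _ + X]big1 ?addr0; last first.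
  move=> mu mulam; rewrite coefZ coef_sum big1_seq ?mulr0// => s /andP[_ smu].
  rewrite coefXn; case: eqP => // e; exfalso; move/eqP: mulam; apply.
  have es : s = map val (val lam).
    apply: (@code_inj d.+1); rewrite ?(size_perm _ _ smu) ?(size_perm _ _ (self _))//.
    - exact: bounded smu.
    - exact: bounded (self _).
  move: smu; rewrite mem_permutations es perm_sym => pe.
  have /andP[slam _] := valP lam; have /andP[smu _] := valP mu.
  apply/val_inj/val_inj/(inj_map val_inj) => /=.
  exact: (sorted_eq geq_trans geq_anti smu slam).
rewrite coefZ coef_sum => /eqP; rewrite mulf_eq0 => /orP[/eqP //|].
(* The multiplier of [u lam] is positive: the tuple itself contributes 1, the other terms are
   nonnegative. *)
rewrite (big_rem _ (self lam)) /= coefXn eqxx /=.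
have ge0 : 0 <= \sum_(s <- rem [seq val i | i <- val lam]
    (permutations [seq val i | i <- val lam]))
    ('X^(code d.+1 s) : {poly R})`_(code d.+1 [seq val i | i <- val lam]).
  by apply: sumr_ge0 => s _; rewrite coefXn ler0n.
by move/eqP => h; move: ge0; have := @ltr01 R; lra.
Qed.

End monomial_independence.

Section macdonald_basis.
Variables (R : realType) (q t : R) (P : forall d : nat, part d -> part d -> R).
Arguments P : clear implicits.
Hypotheses (hq : 0 < q < 1) (ht : 0 < t < 1) (hP : is_macdonald q t P).

Lemma zqt_gt0 d (rho : part d) : 0 < zqt q t rho.
Proof.
have [/andP[q0 q1] /andP[t0 t1]] := (hq, ht).
rewrite /zqt mulr_gt0//.
  rewrite big_nat; elim/big_ind : _ => //= [x y|i /andP[i0 _]]; first exact: mulr_gt0.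
  by rewrite ltr0n muln_gt0 fact_gt0 expn_gt0 i0.
rewrite big_seq; elim/big_ind : _ => //= [x y|k /parts_gt0 k0]; first exact: mulr_gt0.
by rewrite divr_gt0// subr_gt0 exprn_ilt1 ?ltW// -lt0n.
Qed.

(** The scalar product is positive definite on power-sum coefficients, so a zero norm would kill the
    whole monomial expansion of [P d nu], against its leading coefficient 1. *)
Lemma macdonald_norm_gt0 d (nu : part d) : 0 < qt_scalar q t (P d nu) (P d nu).
Proof.
have [_ /(_ nu) [u [u1 _ uE]]] := hP d.
have terms_ge0 rho : 0 <= P d nu rho * P d nu rho * zqt q t rho.
  by rewrite mulr_ge0 ?sqr_ge0 -?expr2 ?sqr_ge0// ltW// zqt_gt0.
rewrite lt_neqAle sumr_ge0 // andbT eq_sym; apply/eqP => /psumr_eq0P H.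
have P0 rho : P d nu rho = 0.
  have /eqP := H (fun i _ => terms_ge0 i) rho isT.
  by rewrite mulf_eq0 (gt_eqF (zqt_gt0 rho)) orbF mulf_eq0 orbb => /eqP.
have := @monomial_sym_free R d u; move=> /(_ _ nu)H'.
suff : u nu = 0 by rewrite u1 => /eqP; rewrite oner_eq0.
apply: H' => xs; rewrite -uE /sym_eval big1// => rho _.
by rewrite P0 mul0r.
Qed.

(* The matrix of the P_nu is A with A Z A^T = D for diagonal invertible Z, D;
   its right inverse Z A^T D^-1 is also a left inverse. *)
Lemma macdonald_basis d (rho : part d) : exists alpha : part d -> R,
  forall rho', \sum_nu alpha nu * P d nu rho' = (rho' == rho)%:R.
Proof.
pose norm nu := qt_scalar q t (P d nu) (P d nu).
exists (fun nu => zqt q t rho * P d nu rho / norm nu) => rho'.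
pose n := #|{: part d}|.
pose A : 'M[R]_n := \matrix_(i, j) P d (enum_val i) (enum_val j).
pose B : 'M[R]_n :=
  \matrix_(j, i) (zqt q t (enum_val j) * P d (enum_val i) (enum_val j)
    / norm (enum_val i)).
have sumE (F : part d -> R) : \sum_(x : part d) F x = \sum_(i < n) F (enum_val i).
  by rewrite -(big_enum_val (A := {: part d}) F) big_mkcond.
have AB : A *m B = 1%:M.
  apply/matrixP => i k; rewrite !mxE.
  transitivity (qt_scalar q t (P d (enum_val i)) (P d (enum_val k)) / norm (enum_val k)).
    rewrite /qt_scalar sumE mulr_suml; apply: eq_bigr => j _; rewrite !mxE.
    by ring.
  have [->|ik] := eqVneq i k; first by rewrite divff// gt_eqF// macdonald_norm_gt0.
  have [-> //] := hP d; first by rewrite mul0r.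
  by move=> /enum_val_inj; exact/eqP.
have /matrixP/(_ (enum_rank rho) (enum_rank rho')) := mulmx1C AB.
rewrite !mxE (inj_eq enum_rank_inj) eq_sym => <-.
rewrite sumE; apply: eq_bigr => i _.
by rewrite !mxE !enum_rankK.
Qed.

End macdonald_basis.

(** * Sums over the nodes of a double signature *)

Lemma exprz_antitone (F : realFieldType) (x : F) (m n : int) : 0 < x < 1 ->
  m <= n -> x ^ n <= x ^ m.
Proof.
move=> /andP[x0 x1] mn.
have -> : n = m + `|n - m|%N%:Z by rewrite gez0_abs ?subr_ge0// addrCA subrr addr0.
by rewrite expfzDr ?gt_eqF// ler_piMr ?exprz_ge0 ?(ltW x0)// -exprnP exprn_ile1 ?ltW.
Qed.

Section node_sums.
Variables (R : realType) (q t zp zm : R).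
Hypotheses (hq : 0 < q < 1) (ht : 0 < t < 1).

(** Coordinates weakly decrease, so the power of [q] does not grow, while the power of [t] gains one
    factor. *)
Lemma node_contract z s i : `|node q t z s i.+1| <= t * `|node q t z s i|.
Proof.
have [/andP[q0 q1] /andP[t0 t1]] := (hq, ht).
rewrite /node; case e : (entry s i.+1) => [m|]; last first.
  by rewrite normr0 mulr_ge0// ltW.
have [m' -> mm'] := entryP e.
have qmm' : q ^ (- m) <= q ^ (- m') by rewrite exprz_antitone// lerN2.
rewrite exprS !normrM (gtr0_norm t0).
rewrite [leRHS](_ : _ = `|z| * `|q ^ (- m')| * (t * `|t ^+ i|)); last by ring.
rewrite ler_wpM2r ?mulr_ge0 ?(ltW t0)// ler_wpM2l//.
by rewrite !ger0_norm ?exprz_ge0 ?(ltW q0).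
Qed.

Lemma node_decay z s i : `|node q t z s i| <= t ^+ i * `|node q t z s 0|.
Proof.
elim: i => [|i IH]; first by rewrite expr0 mul1r.
have /andP[t0 _] := ht.
by rewrite (le_trans (node_contract z s i))// exprS -mulrA ler_wpM2l// ltW.
Qed.

(** [psum] is a formal [limn]; comparison with a geometric series of ratio [t^k] shows that the
    limit exists. *)
Lemma cvg_psum a k : (0 < k)%N ->
  series (fun i => node q t zp a.1 i ^+ k + node q t zm a.2 i ^+ k) @ \oo
    --> psum q t zp zm a k.
Proof.
move=> k0; have /andP[t0 t1] := ht; apply: normed_cvg => /=.
have tk : `|t ^+ k| < 1.
  by rewrite normrX gtr0_norm// exprn_ilt1 ?ltW// -lt0n.
pose c := `|node q t zp a.1 0| ^+ k + `|node q t zm a.2 0| ^+ k.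
apply: (@series_le_cvg _ _ (geometric c (t ^+ k))).
- by move=> i; exact: normr_ge0.
- by move=> i; rewrite /geometric /= mulr_ge0 ?addr_ge0 ?exprn_ge0// ltW.
- move=> i; rewrite /= (le_trans (ler_normD _ _))// !normrX mulrDl.
  rewrite -exprM mulnC exprM -!exprMn ![_ * t ^+ i]mulrC.
  by apply: lerD; rewrite lerXn2r ?nnegrE ?mulr_ge0 ?exprn_ge0 ?node_decay// ltW.
- exact: is_cvg_geometric_series.
Qed.

(** Written through power sums, to which the moment identities apply. For [p] without constant term
    it is the sum of [p] over all nodes. *)
Definition node_sum (p : {poly R}) (a : dsign) : R :=
  \sum_(k < size p) p`_k * psum q t zp zm a k.

Definition node_poly (p : {poly R}) (a : dsign) (i : nat) : R :=
  p.[node q t zp a.1 i] + p.[node q t zm a.2 i].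

Lemma cvg_node_sum (p : {poly R}) a : p`_0 = 0 ->
  series (node_poly p a) @ \oo --> node_sum p a.
Proof.
move=> p0.
rewrite (_ : series _ = fun n => \sum_(k < size p) p`_k *
   series (fun i => node q t zp a.1 i ^+ k + node q t zm a.2 i ^+ k) n); last first.
  apply/funext => n; rewrite /series /=.
  under [RHS]eq_bigr do rewrite big_distrr /=.
  rewrite exchange_big; apply: eq_bigr => i _ /=.
  rewrite /node_poly !horner_coef -big_split; apply: eq_bigr => k _ /=.
  by rewrite mulrDr.
rewrite /node_sum; elim: (size p) => [|n IH].
  rewrite big_ord0; under eq_fun do rewrite big_ord0; exact: cvg_cst.
rewrite big_ord_recr /=; under eq_fun do rewrite big_ord_recr /=.
(* The degree-zero series may diverge; its coefficient [p_0] vanishes. *)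
apply: cvgD => //; case: n {IH} => [|n].
  by rewrite p0 mul0r; under eq_fun do rewrite mul0r; exact: cvg_cst.
by apply: cvgMl_tmp; exact: cvg_psum.
Qed.

(** Unlike [config], this admits the value 0 standing for absent coordinates. *)
Definition is_node (a : dsign) (x : R) : Prop :=
  (exists i, x = node q t zp a.1 i) \/ (exists i, x = node q t zm a.2 i).

Lemma node_sum_le (p p' : {poly R}) a : p`_0 = 0 -> p'`_0 = 0 ->
  (forall x, is_node a x -> p.[x] <= p'.[x]) -> node_sum p a <= node_sum p' a.
Proof.
move=> p0 p'0 pp'; apply: ler_cvg_to (cvg_node_sum p0) (cvg_node_sum p'0) _.
near=> n; apply: ler_sum => i _; apply: lerD; apply: pp'; [left|right]; by exists i.
Unshelve. all: by end_near. Qed.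

(** All terms are nonnegative, so the partial sums increase to the limit and dominate each single
    term. *)
Lemma le_node_sum (p : {poly R}) a x : p`_0 = 0 ->
  (forall y, is_node a y -> 0 <= p.[y]) ->
  is_node a x -> p.[x] <= node_sum p a.
Proof.
move=> p0 p_ge0 ax.
have terms_ge0 i : 0 <= node_poly p a i.
  by apply: addr_ge0; apply: p_ge0; [left|right]; exists i.
have [i xi] : exists i, p.[x] <= node_poly p a i.
  case: ax => -[i ->]; exists i; [rewrite lerDl|rewrite lerDr]; apply: p_ge0;
  [right|left]; by exists i.
apply: (le_trans xi); apply: (@le_trans _ _ (series (node_poly p a) i.+1)).
  by rewrite /series /= big_nat_recr//= lerDr sumr_ge0.
have c := cvg_node_sum (a := a) p0.
rewrite -(cvg_lim _ c)//; apply: nondecreasing_cvgn_le.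
  by apply: nondecreasing_series => n _ _; exact: terms_ge0.
by apply/cvg_ex; exists (node_sum p a).
Qed.

(** Limits of the node series are compared, because the defining finite sums run over different
    sizes. *)
Lemma node_sumD (p p' : {poly R}) a : p`_0 = 0 -> p'`_0 = 0 ->
  node_sum (p + p') a = node_sum p a + node_sum p' a.
Proof.
move=> p0 p'0; have pp' : (p + p')`_0 = 0 by rewrite coefD p0 p'0 addr0.
have := cvgD (cvg_node_sum (a := a) p0) (cvg_node_sum (a := a) p'0).
rewrite (_ : _ + _ = series (node_poly (p + p') a)).
  by move=> h; rewrite -(cvg_lim _ (h _))// -(cvg_lim _ (cvg_node_sum (a := a) pp')).
rewrite -seriesD; congr series; apply/funext => i.
by rewrite /node_poly !hornerD /= addrACA.
Qed.

Lemma node_sumZ c (p : {poly R}) a : p`_0 = 0 -> node_sum (c *: p) a = c * node_sum p a.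
Proof.
move=> p0; have cp : (c *: p)`_0 = 0 by rewrite coefZ p0 mulr0.
have := cvgMl_tmp (a := c) (cvg_node_sum (a := a) p0).
rewrite (_ : (fun _ => _) = series (node_poly (c *: p) a)).
  by move=> h; rewrite -(cvg_lim _ (h _))// -(cvg_lim _ (cvg_node_sum (a := a) cp)).
apply/funext => n; rewrite /series /= big_distrr; apply: eq_bigr => i _ /=.
by rewrite /node_poly !hornerZ mulrDr.
Qed.

End node_sums.

(** * Polynomials isolating a point of a finite set *)

Lemma expr_small (R : realType) (x k : R) : 0 < x < 1 -> 0 < k ->
  exists n, x ^+ n < k.
Proof.
move=> /andP[x0 x1] k0.
have x1' : `|x| < 1 by rewrite ger0_norm ?ltW.
have [n _ h] := cvgr0_norm_lt _ (cvg_expr x1') _ k0.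
by exists n; rewrite -[ltLHS]ger0_norm ?exprn_ge0 ?(ltW x0)//; apply: h => /=.
Qed.

Lemma poly_bounded (R : realFieldType) (p : {poly R}) (c : R) :
  exists2 D, 0 < D & forall x, `|x| <= c -> `|p.[x]| <= D.
Proof.
exists (1 + \sum_(i < size p) `|p`_i| * `|c| ^+ i).
  by rewrite ltr_pwDl// sumr_ge0// => i _; rewrite mulr_ge0// exprn_ge0.
move=> x xc; rewrite horner_coef (le_trans (ler_norm_sum _ _ _))//.
rewrite (le_trans _ (ler_wpDl _ (lexx _)))//.
apply: ler_sum => i _; rewrite normrM normrX ler_wpM2l// lerXn2r ?nnegrE//.
by rewrite (le_trans xc)// ler_norm.
Qed.

(* X^2 (X/s)^(2M) times the Lagrange polynomial of s in S: the middle factor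
   makes it negligible against x^2 on |x| < e/2 when M is large. *)
Lemma isolating_poly (R : realType) (S : seq R) (e s A : R) :
  0 < e -> 0 < A -> e <= `|s| ->
  exists (p : {poly R}) (eta : R),
    [/\ p`_0 = 0, p.[s] = s ^+ 2, 0 < eta, eta * A <= e ^+ 2 / 4 &
    forall x, x != s -> x \in S \/ `|x| < e / 2 -> `|p.[x]| <= eta * x ^+ 2].
Proof.
move=> e0 A0 es.
have s0 : s != 0 by rewrite -normr_gt0 (lt_le_trans e0).
pose Lag : {poly R} := \prod_(r <- S | r != s) ((s - r)^-1 *: ('X - r%:P)).
have [D D0 LagD] := poly_bounded Lag (e / 2).
(* [M] is chosen for the bound [4^-M * D * A <= e^2/4] required of [eta]. *)
have [//||M hM] := @expr_small R 4^-1 (e ^+ 2 / 4 / (D * A)).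
- by rewrite invr_gt0 ltr0n/= invf_lt1 ?ltr0n// ltr1n.
- by rewrite !divr_gt0 ?exprn_gt0 ?mulr_gt0// ltr0n.
pose p : {poly R} := 'X^2 * (s^-1 ^+ 2 *: 'X^2) ^+ M * Lag.
have pE x : p.[x] = x ^+ 2 * (s^-1 ^+ 2 * x ^+ 2) ^+ M * Lag.[x].
  by rewrite 2!hornerM hornerXn horner_exp hornerZ hornerXn.
have LagS : Lag.[s] = 1.
  rewrite horner_prod big1// => r rs; rewrite hornerZ hornerXsubC.
  by rewrite mulVf// subr_eq0 eq_sym.
(* On [|x| < e/2] the Lagrange factor is at most [D], and [(x/s)^2 <= 1/4] because [e <= |s|]. *)
exists p, (4^-1 ^+ M * D); split.
- by rewrite -horner_coef0 pE expr0n /= !mul0r.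
- by rewrite pE LagS -exprMn mulVf// expr1n expr1n !mulr1.
- by rewrite mulr_gt0// exprn_gt0// invr_gt0 ltr0n.
- by rewrite -mulrA -ler_pdivlMr ?mulr_gt0// ltW.
move=> x xs [xS|xe].
  have -> : p.[x] = 0.
    rewrite pE /Lag horner_prod (big_rem x)//= xs hornerZ hornerXsubC subrr.
    by rewrite mulr0 mul0r mulr0.
  by rewrite normr0 mulr_ge0 ?sqr_ge0// mulr_ge0 ?ltW// exprn_gt0// invr_gt0 ltr0n.
rewrite pE 2!normrM.
rewrite [leRHS]mulrC -mulrA ger0_norm ?sqr_ge0// ler_wpM2l ?sqr_ge0//.
apply: ler_pM => //; last by apply: LagD; exact: ltW.
rewrite normrX lerXn2r ?nnegrE ?invr_ge0//.
rewrite -exprMn normrX normrM normfV.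
have h : `|s|^-1 * `|x| <= 2^-1.
  rewrite mulrC ler_pdivrMr ?normr_gt0//.
  by move: xe es; lra.
rewrite (_ : 4^-1 = 2^-1 ^+ 2); last by rewrite exprVn -natrX.
by rewrite lerXn2r ?nnegrE ?mulr_ge0 ?invr_ge0.
Qed.

(** * Recognizing a double signature from finitely many power sums *)

(** The grid below lists exponents as [j - n] with [j] from 0 to [2n]. *)
Lemma absz_window (n : nat) (m : int) : - m < n%:Z -> m <= n%:Z ->
  (`|n%:Z - m|%N < (n + n).+1)%N /\ `|n%:Z - m|%N%:Z - n%:Z = - m.
Proof. by lia. Qed.

Section close_test.
Variables (R : realType) (q t zp zm : R).
Hypotheses (hq : 0 < q < 1) (ht : 0 < t < 1) (hzp : 0 < zp) (hzm : zm < 0).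

(* The set of all q^m t^i may be dense; monotonicity of the signature bounds i
   for the nodes of size at least c, hence also m. *)
Lemma node_grid (z c B : R) : z != 0 -> 0 < c -> 0 < B -> exists S : seq R,
  forall s i, `|node q t z s 0| <= B ->
    node q t z s i \in S \/ `|node q t z s i| < c.
Proof.
move=> z0 c0 B0; have [/andP[q0 q1] /andP[t0 t1]] := (hq, ht).
have z_gt0 : 0 < `|z| by rewrite normr_gt0.
(* From index [I] on, nodes are below [t^I * B < c]. *)
have [I hI] := expr_small ht (divr_gt0 c0 B0).
have tI0 : 0 < t ^+ I by rewrite exprn_gt0.
(* An exponent of [q] at least [n] makes the node smaller than [c]; one below [-n], at an index less
   than [I], makes it exceed [B]. *)
have /(expr_small hq)[n] : 0 < Num.min (c / `|z|) (`|z| * t ^+ I / B).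
  by rewrite lt_min !divr_gt0// mulr_gt0.
rewrite lt_min => /andP[hn1 hn2].
exists [seq z * q ^ (j%:Z - n%:Z) * t ^+ i | j <- iota 0 (n + n).+1, i <- iota 0 I].
move=> s i s0B.
have [iI|Ii] := ltnP i I; last first.
  right; apply: (le_lt_trans (node_decay hq ht z s i)).
  apply: (@le_lt_trans _ _ (t ^+ I * B)); last by rewrite -ltr_pdivlMr.
  by rewrite ler_pM ?exprn_ge0 ?(ltW t0)// ler_wiXn2l// ltW.
have xB : `|node q t z s i| <= B.
  apply: (le_trans (node_decay hq ht z s i)); apply: le_trans s0B.
  by rewrite ler_piMl// exprn_ile1// ltW.
move: xB; rewrite /node; case: (entry s i) => [m|]; last by rewrite normr0; right.
have norm_node k : `|z * q ^ k * t ^+ i| = `|z| * q ^ k * t ^+ i.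
  by rewrite !normrM (gtr0_norm (exprz_gt0 _ q0)) (gtr0_norm (exprn_gt0 _ t0)).
rewrite norm_node => xB.
have [nm|mn] := lerP n%:Z (- m).
  right; apply: (@le_lt_trans _ _ (`|z| * q ^+ n)).
    rewrite -[leRHS]mulr1 ler_pM ?mulr_ge0 ?exprz_ge0 ?exprn_ge0 ?(ltW q0) ?(ltW t0)//.
      by rewrite ler_wpM2l ?(ltW z_gt0)// exprnP exprz_antitone.
    by rewrite exprn_ile1// ltW.
  by rewrite mulrC -ltr_pdivlMr.
have [nm'|mn'] := lerP m n%:Z.
  have [jn jE] := absz_window mn nm'.
  left; apply/allpairsP; exists (`|n%:Z - m|%N, i).
  by split; rewrite ?mem_iota//= jE.
exfalso; move: xB; apply/negP; rewrite -ltNge.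
apply: (@lt_le_trans _ _ (`|z| * (q ^ (- n%:Z)) * t ^+ I)).
  rewrite -exprnN -mulrA [X in _ * X]mulrC mulrA ltr_pdivlMr ?exprn_gt0//.
  by rewrite mulrC -ltr_pdivlMr.
rewrite ler_pM ?mulr_ge0 ?exprz_ge0 ?exprn_ge0 ?(ltW z_gt0) ?(ltW q0) ?(ltW t0)//.
  by rewrite ler_wpM2l ?(ltW z_gt0)// exprz_antitone// lerN2 ltW.
by rewrite ler_wiXn2l ?(ltW t0) ?(ltW t1)// ltnW.
Qed.

Local Notation node_sum := (node_sum q t zp zm).
Local Notation is_node := (is_node q t zp zm).

(** The square of each node is at most the sum of squares [A], so every node has size at most
    [A + 1]. *)
Lemma node_grid_energy (A e : R) : 0 < A -> 0 < e -> exists S : seq R, forall b,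
  node_sum 'X^2 b <= A -> forall x, is_node b x -> x \in S \/ `|x| < e / 2.
Proof.
move=> A0 e0; have e2 : 0 < e / 2 by rewrite divr_gt0.
have B0 : 0 < A + 1 by rewrite addr_gt0.
have [Sp hSp] := node_grid (lt0r_neq0 hzp) e2 B0.
have [Sm hSm] := node_grid (ltr0_neq0 hzm) e2 B0.
exists (Sp ++ Sm) => b bA.
have X20 : ('X^2 : {poly R})`_0 = 0 by rewrite coefXn.
have small x : is_node b x -> `|x| <= A + 1.
  move=> bx; have := le_node_sum hq ht X20 _ bx.
  rewrite hornerXn => /(_ _)/le_trans/(_ bA) h.
  have {h} : x ^+ 2 <= A by apply: h => y _; rewrite hornerXn sqr_ge0.
  by rewrite -real_normK ?num_real//; have := normr_ge0 x; nra.
move=> x [] [i ->]; rewrite mem_cat.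
- have /(hSp _ i)[->|] : `|node q t zp b.1 0| <= A + 1; [|by left|by right].
  by apply: small; left; exists 0%N.
- have /(hSm _ i)[->|] : `|node q t zm b.2 0| <= A + 1; [|by rewrite orbT; left|by right].
  by apply: small; right; exists 0%N.
Qed.

(** Away from the origin the spurious node 0 is excluded. *)
Lemma config_node (e : R) a x : 0 < e ->
  (config q t zp zm a `\` `]- e, e[) x <-> is_node a x /\ e <= `|x|.
Proof.
move=> e0; have outside : ~ (`]- e, e[%classic : set R) x <-> e <= `|x|.
  by rewrite /= in_itv /= -ltr_norml; split => [/negP|?]; [|apply/negP]; rewrite -leNgt.
split=> [[ax /outside ex]|[ax ex]].
  by split => //; case: ax => -[i _ <-]; [left|right]; exists i.
split; last exact/outside.
have x0 : x <> 0 by move=> x0; move: ex; rewrite x0 normr0 leNgt e0.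
case: ax => -[i xi]; [left|right]; exists i => //= ei; apply: x0;
by rewrite xi /node ei.
Qed.

(** The tests are [X^2], which confines the nodes to the grid, and an isolating polynomial for each
    grid point of size at least [e]. The latter sums to at least [3e^2/4] or at most [e^2/4]
    according to whether the point is a node, so a tolerance of [e^2/4] cannot confuse the two
    cases. *)
Lemma close_test a (e : R) : 0 < e -> exists (ps : seq {poly R}) (delta : R),
  [/\ 0 < delta, forall p, p \in ps -> p`_0 = 0 & forall b,
    (forall p, p \in ps -> `|node_sum p b - node_sum p a| < delta) ->
    eps_close q t zp zm e b a].
Proof.
move=> e0; have X20 : ('X^2 : {poly R})`_0 = 0 by rewrite coefXn.
have X2_ge0 b : 0 <= node_sum 'X^2 b.
  have b0 : is_node b (node q t zp b.1 0) by left; exists 0%N.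
  apply: le_trans (le_node_sum hq ht X20 _ b0); first by rewrite hornerXn sqr_ge0.
  by move=> y _; rewrite hornerXn sqr_ge0.
(* The margin 1 covers every [b] whose sum of squares is within 1 of that of [a]. *)
pose A := node_sum 'X^2 a + 1.
have A0 : 0 < A by rewrite ltr_wpDl.
have [S hS] := node_grid_energy A0 e0.
have e24 : 0 < e ^+ 2 / 4 by rewrite divr_gt0 ?exprn_gt0.
have /choice[psi psiP] : forall s, exists p : {poly R}, e <= `|s| -> p`_0 = 0 /\
    forall b, node_sum 'X^2 b <= A -> 
      (is_node b s -> 3 * (e ^+ 2 / 4) <= node_sum p b) /\
      (~ is_node b s -> node_sum p b <= e ^+ 2 / 4).
  move=> s; have [es|_] := boolP (e <= `|s|); last by exists 0.
  have [p [eta [p0 ps eta0 etaA pS]]] := isolating_poly S e0 A0 es.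
  exists p => _; split=> // b bA.
  have etaX0 : (eta *: 'X^2 : {poly R})`_0 = 0 by rewrite coefZ X20 mulr0.
  have etaE x : (eta *: 'X^2 : {poly R}).[x] = eta * x ^+ 2 by rewrite hornerZ hornerXn.
  have etabA : node_sum (eta *: 'X^2) b <= e ^+ 2 / 4.
    by rewrite node_sumZ// (le_trans _ etaA)// ler_wpM2l// ltW.
  have pbound x : is_node b x -> x != s -> `|p.[x]| <= eta * x ^+ 2.
    by move=> bx xs; apply: pS => //; exact: hS bA _ bx.
  split=> [bs|nbs].
    (* [p] may be negative at other nodes; adding [eta X^2] makes it nonnegative at all of them and
       costs at most [e^2/4] in the sum. *)
    have peta0 : (p + eta *: 'X^2)`_0 = 0 by rewrite coefD p0 etaX0 addr0.
    have := le_node_sum hq ht peta0 _ bs.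
    rewrite node_sumD// hornerD etaE ps => /(_ _) h.
    have {}h : s ^+ 2 + eta * s ^+ 2 <= node_sum p b + node_sum (eta *: 'X^2) b.
      apply: h => y by_; rewrite hornerD etaE.
      have [->|ys] := eqVneq y s.
        by rewrite ps addr_ge0 ?sqr_ge0// mulr_ge0 ?sqr_ge0// ltW.
      by have := pbound _ by_ ys; rewrite ler_norml => /andP[h1 _]; lra.
    have : e ^+ 2 <= s ^+ 2.
      by rewrite -[s ^+ 2]real_normK ?num_real// lerXn2r ?nnegrE// ltW.
    have : 0 <= eta * s ^+ 2 by rewrite mulr_ge0 ?sqr_ge0// ltW.
    by move: h etabA; lra.
  (* When [s] is not a node, [eta X^2] dominates [p] at every node. *)
  apply: le_trans etabA; apply: node_sum_le => // x bx.
  have xs : x != s by apply/eqP => xs; apply: nbs; rewrite -xs.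
  by rewrite etaE (le_trans (ler_norm _))// pbound.
exists ('X^2 :: [seq psi s | s <- S & e <= `|s|]), (Num.min 1 (e ^+ 2 / 4)).
split=> [|p|b close]; first by rewrite lt_min ltr01.
  rewrite in_cons => /orP[/eqP -> //|/mapP[s]].
  by rewrite mem_filter => /andP[/psiP[? _] _] ->.
have aA : node_sum 'X^2 a <= A by rewrite lerDl.
have bA : node_sum 'X^2 b <= A.
  have := close 'X^2 (mem_head _ _); rewrite lt_min ltr_norml => /andP[/andP[_] h _].
  by rewrite -lerBlDl ltW.
have agree s : s \in S -> e <= `|s| -> is_node b s <-> is_node a s.
  move=> sS es; have := close (psi s) _; rewrite lt_min => /(_ _)/andP[|_].
    by rewrite in_cons map_f ?orbT// mem_filter es.
  have [_ /[dup] /(_ a aA)[a1 a2] /(_ b bA)[b1 b2]] := psiP s es.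
  rewrite ltr_norml => /andP[d1 d2]; split => [bs|as_].
    by apply: contrapT => /a2; move: (b1 bs) d2; lra.
  by apply: contrapT => /b2; move: (a1 as_) d1; lra.
apply/seteqP; split => x /config_node-/(_ e0)[xn xe]; apply/config_node => //.
- by have [xS|] := hS _ bA _ xn; [split => //; apply/agree|move: xe; lra].
- by have [xS|] := hS _ aA _ xn; [split => //; apply/agree|move: xe; lra].
Qed.

End close_test.

(** * Convergence of moments *)

Lemma cvg_prodr (R : realType) (I : Type) (r : seq I) (F : I -> nat -> R) (l : I -> R) :
  (forall i, F i @ \oo --> l i) ->
  (fun n => \prod_(i <- r) F i n) @ \oo --> \prod_(i <- r) l i.
Proof.
move=> Fl; elim: r => [|i r IH].
  by rewrite big_nil; under eq_fun do rewrite big_nil; exact: cvg_cst.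
by rewrite big_cons; under eq_fun do rewrite big_cons; exact: cvgM.
Qed.

Section qt_pochhammer.
Variables (R : realType) (q t : R).
Hypotheses (hq : 0 < q < 1) (ht : 0 < t < 1).

Lemma cvg_qtpoch d (nu : part d) :
  (fun N => qtpoch q t (t ^+ N) nu) @ \oo --> (1 : R).
Proof.
have /andP[t0 t1] := ht.
(* The limit is the same product at [z = 0], so convergence is checked factor by factor. *)
rewrite (_ : 1 = \prod_(0 <= i < size (parts nu))
    \prod_(0 <= j < nth 0%N (parts nu) i) (1 - 0 * q ^+ j * t ^- i)); last first.
  by rewrite big1// => i _; rewrite big1// => j _; rewrite !mul0r subr0.
apply: cvg_prodr => i; apply: cvg_prodr => j.
apply: cvgB; first exact: cvg_cst.
do 2 apply: cvgMr_tmp; apply: cvg_expr.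
by rewrite ger0_norm// ltW.
Qed.

(** Each factor is [1 - q^j t^(N-i)] with [i < N]. *)
Lemma qtpoch_gt0 d (nu : part d) N : (size (parts nu) <= N)%N ->
  0 < qtpoch q t (t ^+ N) nu.
Proof.
have [/andP[q0 q1] /andP[t0 t1]] := (hq, ht) => nuN.
rewrite /qtpoch big_nat; apply: prodr_gt0 => i /andP[_ inu].
apply: prodr_gt0 => j _; rewrite subr_gt0.
have iN : (i < N)%N := leq_trans inu nuN.
rewrite mulrAC -expfB//; apply: (@le_lt_trans _ _ (t ^+ (N - i))).
  by rewrite ler_piMr ?exprn_ge0 ?(ltW t0)// exprn_ile1 ?ltW.
by rewrite exprn_ilt1 ?(ltW t0)// subn_eq0 -ltnNge.
Qed.

End qt_pochhammer.

Section moments.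
Variables (R : realType) (q t zp zm : R).
Hypotheses (hq : 0 < q < 1) (ht : 0 < t < 1) (hzp : 0 < zp) (hzm : zm < 0).
Variable mu : forall N, {measure set (DSign N) -> \bar R}.
Hypothesis mu1 : forall N, mu N [set: DSign N] = 1%E.

Lemma bounded_integrable N (f : DSign N -> R) B : (forall b, `|f b| <= B) ->
  (mu N).-integrable setT (EFin \o f).
Proof.
move=> fB; apply: measurable_bounded_integrable => //.
  by rewrite mu1 ltry.
exists B; split; first exact: num_real.
by move=> x Bx b _; exact: le_trans (fB b) (ltW Bx).
Qed.

(** Integrability, needed for linearity of the real-valued integral, is asked only eventually: the
    identity for [nu] starts at the level [size (parts nu)]. *)
Definition mean_cvg (F : dsign -> R) (l : R) : Prop :=
  (\forall N \near \oo, (mu N).-integrable setT (EFin \o (fun b => F (val b)))) /\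
  (fun N => \int[mu N]_(b in setT) F (val b)) @ \oo --> l.

Lemma mean_cvg_cst c : mean_cvg (fun _ => c) c.
Proof.
split.
  by apply: nearW => N; apply: (@bounded_integrable _ _ `|c|).
under eq_fun do rewrite Rintegral_cst// mu1 mulr1.
exact: cvg_cst.
Qed.

(** Nothing is assumed on [F]: this disposes of the power sum of degree 0. *)
Lemma mean_cvg_mul0 F l : mean_cvg (fun b => 0 * F b) (0 * l).
Proof.
rewrite mul0r (_ : (fun _ => _) = fun _ => 0); first exact: mean_cvg_cst.
by apply/funext => b; rewrite mul0r.
Qed.

Lemma mean_cvgZ c F l : mean_cvg F l -> mean_cvg (fun b => c * F b) (c * l).
Proof.
move=> [iF Fl]; split.
  by apply: filterS iF => N iF; exact: (integrableZl measurableT c iF).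
apply: cvg_trans; last exact: (cvgMl_tmp Fl).
apply: near_eq_cvg.
by apply: filterS iF => N iF; rewrite RintegralZl.
Qed.

Lemma mean_cvgD F G l l' : mean_cvg F l -> mean_cvg G l' ->
  mean_cvg (fun b => F b + G b) (l + l').
Proof.
move=> [iF Fl] [iG Gl]; split.
  by apply: filterS2 iF iG => N iF iG; exact: (integrableD measurableT iF iG).
apply: cvg_trans; last exact: (cvgD Fl Gl).
apply: near_eq_cvg.
by apply: filterS2 iF iG => N iF iG; rewrite RintegralD.
Qed.

Lemma mean_cvg_sum (I : Type) (r : seq I) (F : I -> dsign -> R) (l : I -> R) :
  (forall i, mean_cvg (F i) (l i)) ->
  mean_cvg (fun b => \sum_(i <- r) F i b) (\sum_(i <- r) l i).
Proof.
move=> Fl; elim: r => [|i r IH].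
  rewrite big_nil (_ : (fun _ => _) = fun _ => 0); last first.
    by apply/funext => b; rewrite big_nil.
  exact: mean_cvg_cst.
rewrite big_cons (_ : (fun _ => _) = fun b => F i b + \sum_(i <- r) F i b).
  exact: mean_cvgD.
by apply/funext => b; rewrite big_cons.
Qed.

Variable P : forall d : nat, part d -> part d -> R.
Arguments P : clear implicits.
Hypothesis hP : is_macdonald q t P.
Variable a : dsign.
Hypothesis mu_macdonald : forall N d (nu : part d), (0 < N)%N ->
  (size (parts nu) <= N)%N ->
  (\int[mu N]_b
     (sym_at q t zp zm (P d nu) (val b) / qtpoch q t (t ^+ N) nu)%:E =
   (sym_at q t zp zm (P d nu) a)%:E)%E.

(** For large [N] the mean is exactly the value at [a] times a Pochhammer factor tending to 1. *)
Lemma mean_cvg_macdonald d (nu : part d) :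
  mean_cvg (sym_at q t zp zm (P d nu)) (sym_at q t zp zm (P d nu) a).
Proof.
pose F := sym_at q t zp zm (P d nu).
have large : \forall N \near \oo,
    (mu N).-integrable setT (EFin \o (fun b => F (val b))) /\
    \int[mu N]_(b in setT) F (val b) = qtpoch q t (t ^+ N) nu * F a.
  exists (maxn 1 (size (parts nu))) => // N /=; rewrite geq_max => /andP[N0 nuN].
  have c0 := qtpoch_gt0 hq ht nuN.
  set c := qtpoch q t (t ^+ N) nu in c0 *.
  have iFc : (mu N).-integrable setT (EFin \o (fun b => F (val b) / c)).
    apply/integrableP; split => //.
    (* A finite value of the integral already forces absolute integrability. *)
    by rewrite integral_fin_num_abs// mu_macdonald.
  have FE : (fun b : DSign N => F (val b)) = (fun b => c * (F (val b) / c)).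
    by apply/funext => b; rewrite mulrC divfK// gt_eqF.
  split; first by rewrite FE; exact: (integrableZl measurableT c iFc).
  by rewrite FE RintegralZl// /Rintegral mu_macdonald.
split; first by apply: filterS large => N [].
rewrite -[X in _ --> X]mul1r.
have lim := cvg_qtpoch q ht nu.
apply: cvg_trans; last exact: (cvgMr_tmp (b := F a) lim).
apply: near_eq_cvg.
by apply: filterS large => N [_ ->].
Qed.

(** A product of power sums is a finite combination of the [P d nu], with coefficients independent
    of the level. *)
Lemma mean_cvg_power_sums d (rho : part d) :
  mean_cvg (fun b => \prod_(k <- parts rho) psum q t zp zm b k)
    (\prod_(k <- parts rho) psum q t zp zm a k).
Proof.
have [alpha alphaE] := macdonald_basis hq ht hP rho.
have E b : \prod_(k <- parts rho) psum q t zp zm b k =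
    \sum_(nu : part d) alpha nu * sym_at q t zp zm (P d nu) b.
  transitivity (\sum_(rho' : part d) (rho' == rho)%:R *
      \prod_(k <- parts rho') psum q t zp zm b k).
    rewrite (bigD1 rho)//= eqxx mul1r [X in _ + X]big1 ?addr0// => rho' /negPf ->.
    by rewrite mul0r.
  under eq_bigr do rewrite -alphaE big_distrl /=.
  rewrite exchange_big; apply: eq_bigr => nu _ /=.
  by rewrite big_distrr; apply: eq_bigr => rho' _ /=; rewrite mulrA.
rewrite E (_ : (fun _ => _) =
    fun b => \sum_(nu : part d) alpha nu * sym_at q t zp zm (P d nu) b).
  apply: mean_cvg_sum => nu; apply: mean_cvgZ; exact: mean_cvg_macdonald.
by apply/funext => b; exact: E.
Qed.

Lemma mean_cvg_psum k : (0 < k)%N ->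
  mean_cvg (psum q t zp zm ^~ k) (psum q t zp zm a k).
Proof.
move=> k0; have [//| | |rho rhoE] := @part_of_seq k [:: k].
- by rewrite mem_seq1 eq_sym -lt0n.
- by rewrite /= addn0.
have := mean_cvg_power_sums rho; rewrite rhoE big_seq1.
by under eq_fun do rewrite big_seq1.
Qed.

Lemma mean_cvg_psumM k l : (0 < k)%N -> (0 < l)%N ->
  mean_cvg (fun b => psum q t zp zm b k * psum q t zp zm b l)
    (psum q t zp zm a k * psum q t zp zm a l).
Proof.
wlog lk : k l / (l <= k)%N => [wlg k0 l0|k0 l0].
  have [lk|/ltnW kl] := leqP l k; first exact: wlg.
  rewrite mulrC; under eq_fun do rewrite mulrC; exact: wlg.
have [| | |rho rhoE] := @part_of_seq (k + l) [:: k; l].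
- by rewrite /= lk.
- by rewrite !inE !(eq_sym 0%N) negb_or -!lt0n k0.
- by rewrite /= addn0.
have := mean_cvg_power_sums rho; rewrite rhoE big_cons big_seq1.
by under eq_fun do rewrite big_cons big_seq1.
Qed.

Local Notation node_sum := (node_sum q t zp zm).

Lemma mean_cvg_node_sum (p : {poly R}) : p`_0 = 0 ->
  mean_cvg (node_sum p) (node_sum p a).
Proof.
move=> p0; apply: mean_cvg_sum => -[[|k] kp] /=.
  by rewrite p0; exact: mean_cvg_mul0.
by apply: mean_cvgZ; exact: mean_cvg_psum.
Qed.

(** The square expands into products of two power sums, again of the form [p_rho]. *)
Lemma mean_cvg_node_sum2 (p : {poly R}) : p`_0 = 0 ->
  mean_cvg (fun b => node_sum p b ^+ 2) (node_sum p a ^+ 2).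
Proof.
move=> p0.
have E b : node_sum p b ^+ 2 = \sum_(k < size p) \sum_(l < size p)
    p`_k * p`_l * (psum q t zp zm b k * psum q t zp zm b l).
  rewrite expr2 {1}/node_sum big_distrl /=; apply: eq_bigr => k _.
  by rewrite big_distrr; apply: eq_bigr => l _ /=; rewrite mulrACA.
rewrite E (_ : (fun _ => _) = fun b => \sum_(k < size p) \sum_(l < size p)
    p`_k * p`_l * (psum q t zp zm b k * psum q t zp zm b l)); last first.
  by apply/funext => b; exact: E.
apply: mean_cvg_sum => -[[|k] kp] /=; apply: mean_cvg_sum => -[[|l] lp] /=.
1,2: by rewrite p0 mul0r; exact: mean_cvg_mul0.
- by rewrite p0 mulr0; exact: mean_cvg_mul0.
- by apply: mean_cvgZ; exact: mean_cvg_psumM.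
Qed.

Lemma mean_cvg_variance (p : {poly R}) : p`_0 = 0 ->
  mean_cvg (fun b => (node_sum p b - node_sum p a) ^+ 2) 0.
Proof.
move=> p0; set h := node_sum p a.
rewrite (_ : (fun _ => _) =
    fun b => (node_sum p b ^+ 2 + (- (2 * h)) * node_sum p b) + h ^+ 2); last first.
  by apply/funext => b; ring.
rewrite (_ : 0 = (h ^+ 2 + (- (2 * h)) * h) + h ^+ 2); last by ring.
apply: mean_cvgD; last exact: mean_cvg_cst.
apply: mean_cvgD; first exact: mean_cvg_node_sum2.
by apply: mean_cvgZ; exact: mean_cvg_node_sum.
Qed.

(** A Chebyshev argument: [V] adds up the squared deviations of the tests. If [V b < delta^2], then
    [b] is close to [a]; otherwise the trivial bound [2B] is at most [C * V b]. *)
Lemma mean_cvg_continuous (f : dsign -> R) (B : R) : (forall b, `|f b| <= B) ->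
  (forall k : R, 0 < k -> exists2 e : R, 0 < e &
     forall b, eps_close q t zp zm e b a -> `|f b - f a| <= k) ->
  (fun N => \int[mu N]_(b in setT) f (val b)) @ \oo --> f a.
Proof.
move=> fB fa; apply/cvgrPdist_le => k k0.
have [e e0 fe] := fa (k / 2) (divr_gt0 k0 (ltr0n _ 2)).
have [ps [delta [delta0 ps0 close]]] := close_test hq ht hzp hzm a e0.
(* The conditional lets the sum lemma, which quantifies over all polynomials, apply; on [ps] the
   condition always holds. *)
pose V b := \sum_(p <- ps) (if p`_0 == 0 then (node_sum p b - node_sum p a) ^+ 2 else 0).
have V0 b : 0 <= V b by apply: sumr_ge0 => p _; case: ifP => // _; exact: sqr_ge0.
have [iV cV] : mean_cvg V 0.
  rewrite [X in mean_cvg _ X](_ : 0 = \sum_(p <- ps) 0); last by rewrite big1.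
  apply: mean_cvg_sum => p; have [|_] := eqVneq p`_0 0; last exact: mean_cvg_cst.
  exact: mean_cvg_variance.
have B0 : 0 <= B by rewrite (le_trans _ (fB a)).
pose C := 2 * B / delta ^+ 2.
have C0 : 0 <= C by rewrite divr_ge0 ?sqr_ge0// mulr_ge0.
have fV b : `|f b - f a| <= k / 2 + C * V b.
  have [Vb|Vb] := ltP (V b) (delta ^+ 2).
    apply: ler_wpDr; first exact: mulr_ge0.
    apply: fe; apply: close => p pps.
    rewrite -(@ltr_pXn2r _ 2) ?nnegrE ?(ltW delta0)// real_normK ?num_real//.
    apply: le_lt_trans Vb; rewrite /V (big_rem p)//= (ps0 _ pps) eqxx lerDl.
    by apply: sumr_ge0 => p' _; case: ifP => // _; exact: sqr_ge0.
  apply: (@le_trans _ _ (2 * B)).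
    by rewrite (le_trans (ler_normB _ _))// mulr_natl mulr2n lerD.
  apply: ler_wpDl; first by rewrite divr_ge0// ltW.
  by rewrite /C -mulrA ler_peMr ?mulr_ge0// mulrC ler_pdivlMr ?exprn_gt0// mul1r.
have near_0 : \forall N \near \oo,
    `|C * \int[mu N]_(b in setT) V (val b)| <= k / 2.
  apply: cvgr0_norm_le; last exact: divr_gt0.
  by rewrite -[X in _ --> X](mulr0 C); exact: cvgMl_tmp.
apply: filterS2 iV near_0 => N iV CVN.
have ifN : (mu N).-integrable setT (EFin \o (fun b => f (val b))).
  exact: bounded_integrable.
have ifa : (mu N).-integrable setT (EFin \o (fun b : DSign N => - f a)).
  exact: (@bounded_integrable _ _ `|- f a|).
have ik : (mu N).-integrable setT (EFin \o (fun b : DSign N => k / 2)).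
  exact: (@bounded_integrable _ _ `|k / 2|).
have iD : (mu N).-integrable setT (EFin \o (fun b : DSign N => f (val b) - f a)).
  exact: (integrableD measurableT ifN ifa).
have iCV : (mu N).-integrable setT (EFin \o (fun b : DSign N => C * V (val b))).
  exact: (integrableZl measurableT C iV).
rewrite distrC (_ : _ - _ = \int[mu N]_(b in setT) (f (val b) - f a)); last first.
  by rewrite RintegralD// Rintegral_cst// mu1 mulr1.
apply: (le_trans (le_normr_Rintegral _ iD)) => //.
apply: (@le_trans _ _ (\int[mu N]_(b in setT) (k / 2 + C * V (val b)))).
  apply: le_Rintegral => //.
  - apply: (le_integrable _ _ _ iD) => //.
    by move=> b _; rewrite /= lee_fin normr_id.
  - exact: (integrableD measurableT ik iCV).
rewrite RintegralD// Rintegral_cst// mu1 mulr1 RintegralZl//.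
by move: CVN; rewrite ler_norml => /andP[_]; lra.
Qed.

End moments.

(** * Mixtures and weak convergence *)

Lemma entry_inj : injective entry.
Proof.
by move=> [e eP] [e' eP'] /= ee'; move: eP; rewrite ee' => eP; congr Signature;
  exact: Prop_irrelevance.
Qed.

(** Neither signature has coordinates from index [N] on, so their first [N] entries determine the
    pair. *)
Lemma DSign_countable N : exists code : DSign N -> nat, injective code.
Proof.
exists (fun b => pickle (mkseq (entry (val b).1) N, mkseq (entry (val b).2) N)).
have finite_entry (b : DSign N) i : (N <= i)%N ->
    entry (val b).1 i = None /\ entry (val b).2 i = None.
  have [k [l [klN hk hl]]] := set_mem (valP b) => Ni.
  split; apply: contrapT.
  - by move=> /(hk i) ik; move: Ni; rewrite -klN leqNgt (leq_trans ik)// leq_addr.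
  - by move=> /(hl i) il; move: Ni; rewrite -klN leqNgt (leq_trans il)// leq_addl.
have mkseq_entry (s s' : signature) : (forall i, (N <= i)%N -> entry s i = entry s' i) ->
    mkseq (entry s) N = mkseq (entry s') N -> s = s'.
  move=> large e; apply/entry_inj/funext => i.
  have [/large //|iN] := leqP N i.
  by rewrite -(nth_mkseq None (entry s) iN) e nth_mkseq.
move=> b b' /(pcan_inj pickleK) [e1 e2].
apply/val_inj; rewrite [val b]surjective_pairing [val b']surjective_pairing.
congr pair; apply: mkseq_entry => // i iN.
- by rewrite (finite_entry b i iN).1 (finite_entry b' i iN).1.
- by rewrite (finite_entry b i iN).2 (finite_entry b' i iN).2.
Qed.

Section mixture.
Context d (X : measurableType d) (R : realType) (N : nat).
Variables (nu : {measure set X -> \bar R}) (K : R.-pker X ~> (DSign N)).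
Variable m : {measure set (DSign N) -> \bar R}.
Hypothesis mE : forall b, m [set b] = (\int[nu]_x K x [set b])%E.
Variable g : DSign N -> R.
Hypothesis g0 : forall b, 0 <= g b.

(** The fibres of an injective code are empty or singletons, so integrals over [DSign N] become
    series; nonnegativity of [g] allows exchanging series and integral. *)
Lemma integral_mixture :
  (\int[m]_b (g b)%:E = \int[nu]_x \int[K x]_b (g b)%:E)%E.
Proof.
have [code code_inj] := DSign_countable N.
pose F i := code @^-1` [set i].
have F1 i : F i = set0 \/ exists b, F i = [set b].
  have [[b bi]|nF] := pselect (exists b, F i b); [right|left].
    exists b; apply/seteqP; split => [b' b'i|_ -> //].
    by apply: code_inj; rewrite b'i bi.
  by rewrite -subset0 => b bi; apply: nF; exists b.
have coverF : \bigcup_i F i = setT by apply/seteqP; split=> // b _; exists (code b).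
have trivF : trivIset setT F.
  apply/trivIsetP => i j _ _ /eqP ij; apply/seteqP; split => // b [/= bi bj].
  by apply: ij; rewrite -bi -bj.
(* [c i] is the value of [g] on the fibre, and 0 on an empty fibre. *)
have /choice[c cP] : forall i, exists r, 0 <= r /\ forall b, F i b -> g b = r.
  move=> i; have [Fi|[b Fi]] := F1 i.
    by exists 0; split => // b; rewrite Fi.
  by exists (g b); split => // b'; rewrite Fi => ->.
have expand (mu : {measure set (DSign N) -> \bar R}) :
    (\int[mu]_b (g b)%:E = \sum_(i <oo) (c i)%:E * mu (F i))%E.
  rewrite -[in LHS]coverF ge0_integral_bigcup//.
    apply: eq_eseriesr => i _; rewrite -integral_cst//.
    by apply: eq_integral => b; rewrite inE => /((cP i).2 b) ->.
  by move=> b _; rewrite lee_fin.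
rewrite expand; under [RHS]eq_integral do rewrite expand.
rewrite integral_nneseries//; last 2 first.
- by move=> i; apply: measurable_funeM; exact: measurable_kernel.
- by move=> i x _; rewrite mule_ge0// lee_fin (cP i).1.
apply: eq_eseriesr => i _.
rewrite ge0_integralZl_EFin//; last 2 first.
- exact: measurable_kernel.
- exact: (cP i).1.
congr (_ * _)%E; have [->|[b ->]] := F1 i; last exact: mE.
by rewrite measure0; under eq_integral do rewrite measure0; rewrite integral0.
Qed.

End mixture.

Section weak_limit.
Variables (R : realType) (q t zp zm : R).
Local Notation T := (dsign_space q t zp zm).

Lemma continuous_eps_close (f : T -> R) : continuous f -> forall (a : T) (k : R),
  0 < k -> exists2 e : R, 0 < e &
    forall b : T, eps_close q t zp zm e b a -> `|f b - f a| <= k.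
Proof.
move=> fc a k k0; have /cvgrPdist_le/(_ k k0) := fc a.
move=> /nbhsP[E [e e0 eE] EP]; exists e => // b ba.
rewrite distrC; apply: (EP b); apply/xsectionP; apply: eE; exact: esym ba.
Qed.

Lemma continuous_borel_measurable (U : ptopologicalType) (f : U -> R) : continuous f ->
  measurable_fun [set: g_sigma_algebraType (open : set (set U))] f.
Proof.
move=> /continuousP fc; apply: (measurability _ (RGenOpens.measurableE R)).
move=> _ [_ [x [y ->] <-]]; rewrite setTI; apply: sub_sigma_algebra.
by apply: fc; exact: interval_open.
Qed.

End weak_limit.

(** * Dominated convergence over the boundary measure *)

Unset Implicit Arguments.

Theorem theoremC (R : realType) (q t zp zm : R)
    (hq : 0 < q < 1) (ht : 0 < t < 1) (hzp : 0 < zp) (hzm : zm < 0)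
    (P : forall d : nat, part d -> part d -> R)
    (hP : is_macdonald q t P)
    (L : forall N : nat, R.-pker (DSign N.+1) ~> (DSign N))
    (hL : is_macdonald_chain q t zp zm P L)
    (Linf : forall N : nat,
      R.-pker (borel (DSign_inf q t zp zm)) ~> (DSign N))
    (hLinf : is_boundary_kernel P Linf)
    (M : forall N : nat, probability (DSign N) R)
    (hM : coherent_system L M)
    (Minf : probability (borel (DSign_inf q t zp zm)) R)
    (hMinf : is_boundary_measure Linf M Minf) :
  weak_cvg (fun N : nat => distribution (M N) (@incl_fin R q t zp zm N))
    (distribution Minf (@incl_inf R q t zp zm)).
Proof.
move=> f fc [B0 [_ fB0]].
pose B := `|B0| + 1.
have fB b : `|f b| <= B.
  by apply: fB0 => //; rewrite /B ltr_pwDr// ler_norm.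
have B_gt0 : 0 < B by rewrite ltr_wpDl.
have f_meas : measurable_fun [set: borel (dsign_space q t zp zm)] f.
  exact: continuous_borel_measurable.
have finf_meas : measurable_fun [set: borel (DSign_inf q t zp zm)]
    (f \o @incl_inf R q t zp zm).
  exact: measurableT_comp (@measurable_incl_inf R q t zp zm).
(* Adding [B] makes the integrand nonnegative, as the mixture formula requires; the constant is
   subtracted afterwards. *)
have pullback d (X : measurableType d) (mu : probability X R)
    (phi : {mfun X >-> borel (dsign_space q t zp zm)}) :
    (\int[distribution mu phi]_x (f x)%:E =
     \int[mu]_x (f (phi x) + B)%:E - B%:E)%E.
  have mu1 : mu setT = 1%E := @probability_setT _ _ _ mu.
  have phi_int : mu.-integrable setT (EFin \o (f \o phi)).
    apply: measurable_bounded_integrable => //.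
    - by move: (ltry (1 : R)); rewrite -mu1.
    - exact: measurableT_comp.
    exists B; split; first exact: num_real.
    by move=> x Bx y _; exact: le_trans (fB _) (ltW Bx).
  have B_int : mu.-integrable setT (EFin \o cst B).
    exact: finite_measure_integrable_cst.
  rewrite integral_distribution//; last exact/measurable_EFinP.
  under [X in (_ = X - _)%E]eq_integral do rewrite EFinD.
  rewrite integralD// integral_cst// [X in (_ * X)%E]mu1 mule1 addeK//.
rewrite pullback; under eq_fun do rewrite pullback.
apply: cvgeB => //; [exact: fin_num_adde_defl| |exact: cvg_cst].
pose g b := f b + B.
have g0 b : 0 <= g b by have := fB b; rewrite ler_norml /g => /andP[]; lra.
have gB b : `|g b| <= 2 * B.
  by rewrite ger0_norm//; have := fB b; rewrite ler_norml /g => /andP[]; lra.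
(* By the mixture formula the integral of [g] against [M N] is that of [h N] against [Minf]; it
   remains to pass to the limit in [h N]. *)
pose h N (a : borel (DSign_inf q t zp zm)) := (\int[Linf N a]_b (g (val b))%:E)%E.
have h_meas N : measurable_fun setT (h N).
  apply: measurable_fun_integral_kernel => //.
  - by move=> U mU; exact: measurable_kernel.
  - by move=> b; rewrite lee_fin.
have h_fin N a : (Linf N a).-integrable setT (EFin \o (fun b => g (val b))).
  apply: (bounded_integrable (mu := fun N => Linf N a)) => // N'; exact: prob_kernel.
have h_cvg a : h ^~ a @ \oo --> (g (val a))%:E.
  have mu1 N : Linf N a setT = 1%E by exact: prob_kernel.
  have gc (k : R) : 0 < k -> exists2 e : R, 0 < e & forall b : dsign,
      eps_close q t zp zm e b (val a) -> `|g b - g (val a)| <= k.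
    move=> /(continuous_eps_close fc (val a))[e e0 fe]; exists e => // b /fe.
    by rewrite /g opprD addrACA subrr addr0.
  have lim := @mean_cvg_continuous R q t zp zm hq ht hzp hzm (fun N => Linf N a) mu1
    P hP (val a) (fun N d nu N0 => hLinf N a N0 d nu) g _ gB gc.
  apply/fine_cvgP; split => //.
  by apply: nearW => N; exact: (integrable_fin_num measurableT (h_fin N a)).
have h_bound N a : (`|h N a| <= (2 * B)%:E)%E.
  have h0 : (0 <= h N a)%E by apply: integral_ge0 => b _; rewrite lee_fin.
  rewrite gee0_abs// -[leRHS]mule1 -(prob_kernel (s := Linf N) a) -integral_cst//.
  apply: ge0_le_integral => // b _; rewrite lee_fin//.
  by rewrite (le_trans (ler_norm _)).
have g_meas : measurable_fun setT (fun a : borel (DSign_inf q t zp zm) => (g (val a))%:E).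
  by apply/measurable_EFinP; exact: measurable_funD finf_meas (measurable_cst B).
(* The constant [2 * B] dominates, and is integrable because [Minf] is a probability. *)
have [_ _] := dominated_convergence measurableT h_meas
  g_meas
  (aeW _ (fun a _ => h_cvg a)) (finite_measure_integrable_cst Minf (2 * B) measurableT)
  (aeW _ (fun a N _ => h_bound N a)).
apply: cvg_trans; apply: near_eq_cvg.
(* The identity for the boundary measure is available from level 1 on. *)
exists 1%N => // N /= N0; rewrite -(@integral_mixture _ _ _ N Minf (Linf N) (M N))// => b.
exact: hMinf.
Qed.
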